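(* Let $a,b_1,b_2,c_1,c_2$ be complex parameters. In each of the following pairs, the two functions satisfy the same ordinary differential equation in $x$ (of order $2$ or $3$): (i) $F_2(a;b_1,b_2;c_1,c_2;\,x,0)$ and ${}_2F_1(a,b_1;c_1;\,x)$; (ii) $F_2(a;b_1,b_2;c_1,c_2;\,x,1)$ and ${}_3F_2(a,\,b_1,\,a-c_2+1;\;c_1,\,a+b_2-c_2+1;\;x)$; (iii) $F_2(a;b_1,b_2;c_1,c_2;\,x,1-x)$ and $(1-x)^{-a}\,{}_3F_2\!\left(a,\,c_1-b_1,\,a-c_2+1;\;c_1,\,a+b_2-c_2+1;\;\frac{x}{x-1}\right)$.
   Context: $(\alpha)_n=\alpha(\alpha+1)\cdots(\alpha+n-1)$. Appell's series is $$F_2(a;b_1,b_2;c_1,c_2;x,y)=\sum_{n,m\ge 0}\frac{(a)_{n+m}(b_1)_n(b_2)_m}{(c_1)_n(c_2)_m\,n!\,m!}x^ny^m .$$ It satisfies the rank 4 holonomic system $$x(1-x)F_{xx}-xyF_{xy}+(c_1-(a+b_1+1)x)F_x-b_1yF_y-ab_1F=0,$$ $$y(1-y)F_{yy}-xyF_{xy}+(c_2-(a+b_2+1)y)F_y-b_2xF_x-ab_2F=0 .$$ Gauss function: ${}_2F_1(A,B;C;z)=\sum_n \frac{(A)_n(B)_n}{(C)_n n!}z^n$, satisfying Euler's equation $z(1-z)y''+(C-(A+B+1)z)y'-ABy=0$. The series ${}_3F_2(A,B,C;D,E;x)=\sum_n\frac{(A)_n(B)_n(C)_n}{(D)_n(E)_n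 n!}x^n$ satisfies $x^2(1-x)y'''+x(D+E+1-(A+B+C+3)x)y''+(DE-(AB+AC+BC+A+B+C+1)x)y'-ABC\,y=0$. Univariate specialization: for a holomorphic map $\Phi:t\mapsto(x(t),y(t))$ from an open subset of $\mathbf C$ to $\mathbf C^2$, $F(x(t),y(t))=F\circ\Phi$. The partial differential form under $\Phi$ of an ODE $E$ in $t$ is obtained by replacing $t$-derivatives by partial derivatives via the chain rule ($\frac{dF}{dt}=\dot xF_x+\dot yF_y$, etc.). The specialized form under $\Phi$ of a linear PDE is obtained by substituting $x=x(t),y=y(t)$ into the coefficients of the partial derivatives. $E$ follows fully from a PDE system $H$ under $\Phi$ if its partial differential form coincides with the specialized form of some PDE that follows from $H$ by algebraic and partial differentiation operations. The ODE satisfied by a univariate specialization of an Appell function is understood as one following fully from its PDE system (so it is satisfied by $F\circ\Phi$ for every solution $F$ of the system holomorphic on the image of $\Phi$). Here the maps $\Phi$ are $x\mapsto(x,0)$, $x\mapsto(x,1)$, $x\mapsto(x,1-x)$. For a transformed function $\theta(x)\,f(\varphi(x))$, the ODE meant is the pull-back of the hypergeometric equation of $f$ by $z=\varphi(x)$ followed by multiplication of solutions by $\theta$. *)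

(* Defs.v *)
From HB Require Import structures.
From mathcomp Require Import all_boot all_order all_algebra.
From mathcomp Require Import generic_quotient fraction.
From mathcomp Require Import ring reals complex.

Set Implicit Arguments.
Unset Strict Implicit.
Unset Printing Implicit Defensive.

Import GRing.Theory.
Local Open Scope ring_scope.

Notation "x %:F" := (@FracField.tofrac _ x) : ring_scope.

(* The two variables of K[x, y] = {poly {poly K}} follow the convention of
   polyXY: x is the outer variable 'X, and y is the inner one 'X%:P. *)
Notation ratfun1 K := {fraction {poly K}}.
Notation ratfun2 K := {fraction {poly {poly K}}}.

(* A linear differential operator is encoded by its polynomial of coefficients:
   L`_k is the coefficient of (d/dt)^k, P`_i`_j that of (d/dx)^i (d/dy)^j.
   Coefficients stand on the left; the product of {poly _} is not the
   composition of operators, except for the left product by a coefficient. *)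
Notation ode K := {poly ratfun1 K}.
Notation pde K := {poly {poly ratfun2 K}}.

Section FractionDerivation.
Variables (R : idomainType) (d : R -> R).

(* The quotient rule, on a representative; see fracder_div. *)
Definition fracder (f : {fraction R}) : {fraction R} :=
  let n := \n_(repr f) in let m := \d_(repr f) in
  (d n * m - n * d m)%:F / (m ^+ 2)%:F.

Lemma frac_repr (f : {fraction R}) : f = (\n_(repr f))%:F / (\d_(repr f))%:F.
Proof.
have m0 := denom_ratioP (repr f).
apply: (mulIf (x := (\d_(repr f))%:F)); first by rewrite tofrac_eq0.
rewrite divfK ?tofrac_eq0 //.
transitivity (\pi_({fraction R})%qT
  (FracField.mulf (repr f) (Ratio \d_(repr f) 1))).
  by rewrite FracField.pi_mul reprK; congr (_ * _); rewrite !piE.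
rewrite /FracField.tofrac; unlock.
apply/eqmodP; rewrite /= FracField.equivfE /FracField.mulf.
by rewrite !numden_Ratio ?mulf_neq0 ?oner_eq0 // !mulr1 mulrC.
Qed.

Lemma fracder_div :
  (forall u v, d (u * v) = d u * v + u * d v) ->
  forall n m, m != 0 ->
  fracder (n%:F / m%:F) = (d n * m - n * d m)%:F / (m ^+ 2)%:F.
Proof.
move=> dM n m m0; rewrite /fracder.
move: (frac_repr (n%:F / m%:F)) (denom_ratioP (repr (n%:F / m%:F))).
move: (\n_(repr _)) (\d_(repr _)) => n' m' E m'0.
have {}E : n * m' = n' * m.
  apply/eqP; rewrite -tofrac_eq !tofracM; apply/eqP.
  move: E => /(congr1 (fun z => z * m%:F * m'%:F)).
  by rewrite divfK ?tofrac_eq0 // => ->; rewrite mulrAC divfK ?tofrac_eq0.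
have dE := congr1 d E; rewrite !dM in dE.
apply/eqP; rewrite eqr_div ?tofrac_eq0 ?expf_neq0 // -!tofracM tofrac_eq.
apply/eqP.
have dE' : d n' * m = d n * m' + n * d m' - n' * d m by rewrite dE addrK.
have -> : (d n' * m' - n' * d m') * m ^+ 2 =
    (d n' * m) * (m' * m) - (n' * m) * (d m' * m) by ring.
rewrite dE' -E.
have -> : (d n * m' + n * d m' - n' * d m) * (m' * m) =
    (d n * m' + n * d m') * (m' * m) - (n' * m) * (d m * m') by ring.
by rewrite -E; ring.
Qed.

End FractionDerivation.

Section DifferentialOperators.
Variable K : fieldType.

Definition rat1C (c : K) : ratfun1 K := c%:P%:F.
Definition rat1X : ratfun1 K := 'X%:F.
Definition rat2C (c : K) : ratfun2 K := c%:P%:P%:F.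
Definition rat2X : ratfun2 K := 'X%:F.
Definition rat2Y : ratfun2 K := 'X%:P%:F.

Definition Dt : ratfun1 K -> ratfun1 K := fracder (@deriv K).
Definition Dx : ratfun2 K -> ratfun2 K := fracder (@deriv {poly K}).
Definition Dy : ratfun2 K -> ratfun2 K := fracder (map_poly (@deriv K)).

(* The composites d/dt o L, d/dx o P and d/dy o P. *)
Definition ode_Dt (L : ode K) : ode K := map_poly Dt L + 'X * L.
Definition pde_Dx (P : pde K) : pde K := map_poly (map_poly Dx) P + 'X * P.
Definition pde_Dy (P : pde K) : pde K := map_poly (map_poly Dy) P + 'X%:P * P.

Definition ode_order (L : ode K) : nat := (size L).-1.

Inductive pde_follows (H : seq (pde K)) : pde K -> Prop :=
| PdeGen P of P \in H : pde_follows H P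
| PdeAdd P Q of pde_follows H P & pde_follows H Q : pde_follows H (P + Q)
| PdeMul (f : ratfun2 K) P of pde_follows H P : pde_follows H (f%:P%:P * P)
| PdeDx P of pde_follows H P : pde_follows H (pde_Dx P)
| PdeDy P of pde_follows H P : pde_follows H (pde_Dy P).

(* Phi = (x(t), y(t)), with polynomial components. *)
Definition spec_poly (Phi : {poly K} * {poly K}) (p : {poly {poly K}}) :
    {poly K} :=
  (map_poly (fun q => q \Po Phi.2) p).[Phi.1].

(* Only the rational functions without a pole along the image of Phi can be
   specialized, so that this is a relation. *)
Definition spec_ratfun (Phi : {poly K} * {poly K}) (f : ratfun2 K)
    (g : ratfun1 K) : Prop :=
  exists n m : {poly {poly K}},
    [/\ spec_poly Phi m != 0, f = n%:F / m%:F
      & g = (spec_poly Phi n)%:F / (spec_poly Phi m)%:F].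

(* Partial differential expressions along Phi: Q`_i`_j is the coefficient, a
   function of t, of the partial derivative (d/dx)^i (d/dy)^j F at Phi(t). *)
Definition specialized_form (Phi : {poly K} * {poly K}) (P : pde K)
    (Q : {poly {poly ratfun1 K}}) : Prop :=
  forall i j : nat, spec_ratfun Phi P`_i`_j Q`_i`_j.

(* d/dt of such an expression, by the chain rule. *)
Definition chain_Dt (Phi : {poly K} * {poly K})
    (Q : {poly {poly ratfun1 K}}) : {poly {poly ratfun1 K}} :=
  map_poly (map_poly Dt) Q
  + (Dt Phi.1%:F)%:P%:P * ('X * Q) + (Dt Phi.2%:F)%:P%:P * ('X%:P * Q).

Definition partial_form (Phi : {poly K} * {poly K}) (L : ode K) :
    {poly {poly ratfun1 K}} :=
  \sum_(k < size L) (L`_k)%:P%:P * iter k (chain_Dt Phi) 1.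

Definition follows_fully (H : seq (pde K)) (Phi : {poly K} * {poly K})
    (L : ode K) : Prop :=
  exists P : pde K,
    pde_follows H P /\ specialized_form Phi P (partial_form Phi L).

Definition appellF2_pde1 (a b1 c1 : K) : pde K :=
  let x := rat2X in let y := rat2Y in
  (x * (1 - x))%:P%:P * 'X^2 - (x * y)%:P%:P * ('X * 'X%:P)
  + (rat2C c1 - rat2C (a + b1 + 1) * x)%:P%:P * 'X
  - (rat2C b1 * y)%:P%:P * 'X%:P - (rat2C (a * b1))%:P%:P.

Definition appellF2_pde2 (a b2 c2 : K) : pde K :=
  let x := rat2X in let y := rat2Y in
  (y * (1 - y))%:P%:P * ('X%:P) ^+ 2 - (x * y)%:P%:P * ('X * 'X%:P)
  + (rat2C c2 - rat2C (a + b2 + 1) * y)%:P%:P * 'X%:P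
  - (rat2C b2 * x)%:P%:P * 'X - (rat2C (a * b2))%:P%:P.

Definition appellF2_system (a b1 b2 c1 c2 : K) : seq (pde K) :=
  [:: appellF2_pde1 a b1 c1; appellF2_pde2 a b2 c2].

Definition ode_2F1 (A B C : K) : ode K :=
  let z := rat1X in
  (z * (1 - z)) *: 'X^2 + (rat1C C - rat1C (A + B + 1) * z) *: 'X
  - (rat1C (A * B))%:P.

Definition ode_3F2 (A B C D E : K) : ode K :=
  let z := rat1X in
  (z ^+ 2 * (1 - z)) *: 'X^3
  + (z * (rat1C (D + E + 1) - rat1C (A + B + C + 3%:R) * z)) *: 'X^2
  + (rat1C (D * E)
     - rat1C (A * B + A * C + B * C + A + B + C + 1) * z) *: 'X
  - (rat1C (A * B * C))%:P.

(* f(phi(x)); meaningful for nonconstant phi, where the denominator of f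
   cannot vanish at phi. *)
Definition ratfun_comp (f phi : ratfun1 K) : ratfun1 K :=
  (map_poly rat1C \n_(repr f)).[phi] / (map_poly rat1C \d_(repr f)).[phi].

(* Change of variable z = phi(x): d/dz becomes phi'(x)^-1 d/dx. *)
Definition ode_pullback (phi : ratfun1 K) (L : ode K) : ode K :=
  \sum_(k < size L)
    ratfun_comp L`_k phi *: iter k (fun M => (Dt phi)^-1 *: ode_Dt M) 1.

(* The equation of the functions theta * f, for the solutions f of L: d/dx
   becomes theta o d/dx o theta^-1 = d/dx - theta'/theta.  Only the logarithmic
   derivative l = theta'/theta is needed; theta need not be rational. *)
Definition ode_mulsol (l : ratfun1 K) (L : ode K) : ode K :=
  \sum_(k < size L) L`_k *: iter k (fun M => ode_Dt M - l *: M) 1.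

(* The logarithmic derivative of the power u ^ s, for s : K. *)
Definition dlog_power (u : ratfun1 K) (s : K) : ratfun1 K :=
  rat1C s * (Dt u / u).

End DifferentialOperators.

Arguments rat1X {K}.
Arguments rat2X {K}.
Arguments rat2Y {K}.

(* Main.v *)
Require Import Defs.
From HB Require Import structures.
From mathcomp Require Import all_boot all_order all_algebra.
From mathcomp Require Import ring fraction reals complex.

(* Write P1 and P2 for the two equations of the Appell system, and D for the
   derivation d/dt along the curve.
   (i) On y = 0 the equation P1 is Euler's equation itself.
   (ii) On y = 1 the coefficient of F_yy in P2 vanishes, and with
   theta = x d/dx the part of P1, P2 involving F_y is - (theta + b1) F_y and
   - (theta + e) F_y, where e = a + b2 - c2 + 1.  As these two operators
   commute, (theta + e) P1 - (theta + b1) P2 is free of F_y.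
   (iii) On y = 1 - x one has D = d/dx - d/dy, and modulo F and D F
     P1      = x y D F_x + (c1 - b1 - (a + 1) x) F_x,
     P1 + P2 = x y D^2 F + s F_x,     s = c1 + c2 - a - b1 - b2 - 1.
   Since s is a constant,
     x y D (P1 + P2) - s P1 + (c1 - b1 - (a + 1) x) (P1 + P2)
   is free of F_x; up to the factor x - 1 it is the pulled-back equation. *)

Set Implicit Arguments.
Unset Strict Implicit.
Unset Printing Implicit Defensive.

Import GRing.Theory.
Local Open Scope ring_scope.

(** * Derivations, extended to polynomials and to fractions *)

Section Derivation.
Variables (R : comNzRingType) (d : R -> R).

(** A predicate on plain functions, because [Dt], [Dx], [Dy] and their extensions by [map_poly] are
    plain functions. *)
Definition derivation : Prop :=
  {morph d : u v / u + v} /\ (forall u v, d (u * v) = d u * v + u * d v).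

Hypothesis dd : derivation.

Lemma derivationD : {morph d : u v / u + v}. Proof. exact: dd.1. Qed.
Lemma derivationM u v : d (u * v) = d u * v + u * d v. Proof. exact: dd.2. Qed.
Lemma derivation0 : d 0 = 0.
Proof. by apply: (addIr (d 0)); rewrite -derivationD !add0r. Qed.
Lemma derivationN u : d (- u) = - d u.
Proof. by apply: (addIr (d u)); rewrite -derivationD !addNr derivation0. Qed.
Lemma derivationB u v : d (u - v) = d u - d v.
Proof. by rewrite derivationD derivationN. Qed.
Lemma derivation1 : d 1 = 0.
Proof.
by apply: (addIr (d 1)); rewrite add0r -{3}(mulr1 1) derivationM mulr1 mul1r.
Qed.

Lemma derivation_sum I (r : seq I) (F : I -> R) :
  d (\sum_(i <- r) F i) = \sum_(i <- r) d (F i).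
Proof. by apply: (big_morph d derivationD derivation0). Qed.

Lemma coef_map_derivation (p : {poly R}) i : (map_poly d p)`_i = d p`_i.
Proof. by rewrite coef_map_id0 // derivation0. Qed.

Lemma map_polyC_derivation u : map_poly d u%:P = (d u)%:P.
Proof.
apply/polyP => i; rewrite coef_map_derivation !coefC.
by case: eqP => _; rewrite ?derivation0.
Qed.

Lemma map_polyX_derivation : map_poly d 'X = 0.
Proof.
apply/polyP => i; rewrite coef_map_derivation coefX coef0.
by case: eqP => _; rewrite ?derivation1 ?derivation0.
Qed.

End Derivation.

Lemma map_poly_derivation (R : comNzRingType) (d : R -> R) :
  derivation d -> derivation (map_poly d).
Proof.
move=> dd; split=> u v; apply/polyP => i.
  by rewrite !(coefD, coef_map_derivation dd) (derivationD dd).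
rewrite coef_map_derivation // coefD !coefM derivation_sum // -big_split /=.
by apply: eq_bigr => j _; rewrite (derivationM dd) !coef_map_derivation.
Qed.

(** The symbols ['X] and ['X%:P] of d/dx and d/dy are constants for the derivation of the
    coefficients, so an explicit operator is differentiated by the Leibniz rule in the ring of
    symbols. *)
Lemma map_poly2X (F : comNzRingType) (d : F -> F) : derivation d ->
  map_poly (map_poly d) 'X = 0.
Proof. by move=> dd; exact: map_polyX_derivation (map_poly_derivation dd). Qed.

Lemma map_poly2Y (F : comNzRingType) (d : F -> F) : derivation d ->
  map_poly (map_poly d) 'X%:P = 0.
Proof.
move=> dd; rewrite (map_polyC_derivation (map_poly_derivation dd)).
by rewrite (map_polyX_derivation dd).
Qed.

Lemma map_poly2C (F : comNzRingType) (d : F -> F) u : derivation d ->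
  map_poly (map_poly d) u%:P%:P = (d u)%:P%:P.
Proof.
move=> dd; rewrite (map_polyC_derivation (map_poly_derivation dd)).
by rewrite (map_polyC_derivation dd).
Qed.

Lemma map_poly2C0 (F : comNzRingType) (d : F -> F) u : derivation d ->
  d u = 0 -> map_poly (map_poly d) u%:P%:P = 0.
Proof. by move=> dd u0; rewrite map_poly2C // u0 !polyC0. Qed.

Lemma map_poly2C1 (F : comNzRingType) (d : F -> F) u : derivation d ->
  d u = 1 -> map_poly (map_poly d) u%:P%:P = 1.
Proof. by move=> dd u1; rewrite map_poly2C // u1 !polyC1. Qed.

(** By [fracder_div] the quotient rule may be read on any representative, so sums and products are
    differentiated over the product of the denominators and compared by cross-multiplication. *)
Lemma fracder_derivation (R : idomainType) (d : R -> R) :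
  derivation d -> derivation (fracder d).
Proof.
move=> dd; have dM := derivationM dd.
split=> u v; rewrite (frac_repr u) (frac_repr v).
  have m0 := denom_ratioP (repr u); have m0' := denom_ratioP (repr v).
  move: (\n_(repr u)) (\d_(repr u)) (\n_(repr v)) (\d_(repr v)) m0 m0'.
  move=> n m n' m' m0 m0'.
  rewrite addf_div ?tofrac_eq0 // -!(tofracM, tofracD).
  rewrite !fracder_div ?mulf_neq0 // (derivationD dd) !dM.
  rewrite addf_div ?tofrac_eq0 ?expf_neq0 // -!(tofracM, tofracD).
  apply/eqP; rewrite eqr_div ?tofrac_eq0 ?mulf_neq0 ?expf_neq0 ?mulf_neq0 //.
  by rewrite -!tofracM tofrac_eq; apply/eqP; ring.
have m0 := denom_ratioP (repr u); have m0' := denom_ratioP (repr v).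
move: (\n_(repr u)) (\d_(repr u)) (\n_(repr v)) (\d_(repr v)) m0 m0'.
move=> n m n' m' m0 m0'.
rewrite mulf_div -!(tofracM, tofracD).
rewrite !fracder_div ?mulf_neq0 // !dM !mulf_div.
rewrite addf_div ?mulf_neq0 ?tofrac_eq0 ?expf_neq0 // -!(tofracM, tofracD).
apply/eqP; rewrite eqr_div ?tofrac_eq0 ?mulf_neq0 ?expf_neq0 ?mulf_neq0 //.
by rewrite -!tofracM tofrac_eq; apply/eqP; ring.
Qed.

Lemma fracder_tofrac (R : idomainType) (d : R -> R) u :
  derivation d -> fracder d u%:F = (d u)%:F.
Proof.
move=> dd; have := fracder_div (derivationM dd) u (oner_neq0 R).
by rewrite (derivation1 dd) mulr0 subr0 expr1n tofrac1 !divr1 mulr1.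
Qed.

Lemma deriv_derivation (R : comNzRingType) : derivation (@deriv R).
Proof. by split=> u v; rewrite ?derivD ?derivM. Qed.

(** * Derivatives and constants in the rational function fields *)

Section Operators.
Variable K : fieldType.

Lemma Dx_derivation : derivation (@Dx K).
Proof. exact/fracder_derivation/deriv_derivation. Qed.
Lemma Dy_derivation : derivation (@Dy K).
Proof. exact/fracder_derivation/map_poly_derivation/deriv_derivation. Qed.
Lemma Dt_derivation : derivation (@Dt K).
Proof. exact/fracder_derivation/deriv_derivation. Qed.

Lemma Dx_C c : Dx (rat2C c) = 0 :> ratfun2 K.
Proof.
by rewrite /Dx fracder_tofrac ?derivC ?tofrac0 //; exact: deriv_derivation.
Qed.
Lemma Dx_X : Dx rat2X = 1 :> ratfun2 K.
Proof.
by rewrite /Dx fracder_tofrac ?derivX ?tofrac1 //; exact: deriv_derivation.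
Qed.
Lemma Dx_Y : Dx rat2Y = 0 :> ratfun2 K.
Proof.
by rewrite /Dx fracder_tofrac ?derivC ?tofrac0 //; exact: deriv_derivation.
Qed.
Lemma Dy_C c : Dy (rat2C c) = 0 :> ratfun2 K.
Proof.
have dd := @deriv_derivation K.
rewrite /Dy fracder_tofrac ?map_polyC_derivation ?derivC ?tofrac0 //.
exact: map_poly_derivation.
Qed.
Lemma Dy_X : Dy rat2X = 0 :> ratfun2 K.
Proof.
have dd := @deriv_derivation K.
rewrite /Dy fracder_tofrac ?map_polyX_derivation ?tofrac0 //.
exact: map_poly_derivation.
Qed.
Lemma Dy_Y : Dy rat2Y = 1 :> ratfun2 K.
Proof.
have dd := @deriv_derivation K.
rewrite /Dy fracder_tofrac ?map_polyC_derivation ?derivX ?tofrac1 //.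
exact: map_poly_derivation.
Qed.

Lemma rat1CD c e : rat1C (c + e) = rat1C c + rat1C e :> ratfun1 K.
Proof. by rewrite /rat1C polyCD tofracD. Qed.
Lemma rat1CN c : rat1C (- c) = - rat1C c :> ratfun1 K.
Proof. by rewrite /rat1C polyCN tofracN. Qed.
Lemma rat1CM c e : rat1C (c * e) = rat1C c * rat1C e :> ratfun1 K.
Proof. by rewrite /rat1C polyCM tofracM. Qed.
Lemma rat1C1 : rat1C 1 = 1 :> ratfun1 K.
Proof. by rewrite /rat1C polyC1 tofrac1. Qed.
Lemma rat2CD c e : rat2C (c + e) = rat2C c + rat2C e :> ratfun2 K.
Proof. by rewrite /rat2C !polyCD tofracD. Qed.
Lemma rat2CN c : rat2C (- c) = - rat2C c :> ratfun2 K.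
Proof. by rewrite /rat2C !polyCN tofracN. Qed.
Lemma rat2CM c e : rat2C (c * e) = rat2C c * rat2C e :> ratfun2 K.
Proof. by rewrite /rat2C !polyCM tofracM. Qed.
Lemma rat2C1 : rat2C 1 = 1 :> ratfun2 K.
Proof. by rewrite /rat2C !polyC1 tofrac1. Qed.

Lemma Dt_C c : Dt (rat1C c) = 0 :> ratfun1 K.
Proof.
by rewrite /Dt fracder_tofrac ?derivC ?tofrac0 //; exact: deriv_derivation.
Qed.
Lemma Dt_X : Dt rat1X = 1 :> ratfun1 K.
Proof.
by rewrite /Dt fracder_tofrac ?derivX ?tofrac1 //; exact: deriv_derivation.
Qed.

End Operators.

(* The operators of the system in an arbitrary commutative ring; X and Y stand
   for the symbols of d/dx and d/dy.  The second equation is the first one with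
   the roles of x and y exchanged. *)
Section Symbols.
Variable A : comNzRingType.
Implicit Types (X Y x y a b c : A).

Definition F2sym X Y x y a b c : A :=
  x * (1 - x) * X ^+ 2 - x * y * (X * Y) + (c - (a + b + 1) * x) * X
  - b * y * Y - a * b.

(** [F2sym_dx] and [F2sym_dy] expand the composites of d/dx and d/dy with the operator, leaving no
    derivation in the formula. Specialization to a curve does not commute with partial derivatives,
    so these are taken first and the resulting ring expressions are specialized. *)
Definition F2sym_dx X Y x y a b c : A :=
  (1 - (x + x)) * X ^+ 2 - y * (X * Y) - (a + b + 1) * X
  + X * F2sym X Y x y a b c.

Definition F2sym_dy X Y x y a b c : A :=
  - x * (X * Y) - b * Y + Y * F2sym X Y x y a b c.

Lemma derivation_F2sym_dx (d : A -> A) X Y x y a b c : derivation d ->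
  d X = 0 -> d Y = 0 -> d x = 1 -> d y = 0 -> d a = 0 -> d b = 0 -> d c = 0 ->
  d (F2sym X Y x y a b c) + X * F2sym X Y x y a b c = F2sym_dx X Y x y a b c.
Proof.
move=> dd dX dY dx dy da db dc; rewrite /F2sym_dx {1}/F2sym !expr2.
rewrite !(derivationD dd, derivationN dd, derivationM dd, derivation1 dd).
by rewrite dX dY dx dy da db dc; ring.
Qed.

Lemma derivation_F2sym_dy (d : A -> A) X Y x y a b c : derivation d ->
  d X = 0 -> d Y = 0 -> d x = 0 -> d y = 1 -> d a = 0 -> d b = 0 -> d c = 0 ->
  d (F2sym X Y x y a b c) + Y * F2sym X Y x y a b c = F2sym_dy X Y x y a b c.
Proof.
move=> dd dX dY dx dy da db dc; rewrite /F2sym_dy {1}/F2sym !expr2.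
rewrite !(derivationD dd, derivationN dd, derivationM dd, derivation1 dd).
by rewrite dX dY dx dy da db dc; ring.
Qed.

End Symbols.

Lemma F2sym1_poly (F : comNzRingType) (x y a b c : F) :
  (x * (1 - x))%:P%:P * 'X^2 - (x * y)%:P%:P * ('X * 'X%:P)
  + (c - (a + b + 1) * x)%:P%:P * 'X - (b * y)%:P%:P * 'X%:P - (a * b)%:P%:P
  = F2sym 'X 'X%:P x%:P%:P y%:P%:P a%:P%:P b%:P%:P c%:P%:P
  :> {poly {poly F}}.
Proof.
by rewrite /F2sym !(polyCD, polyCN, polyCM, polyC1).
Qed.

Lemma F2sym2_poly (F : comNzRingType) (x y a b c : F) :
  (y * (1 - y))%:P%:P * ('X%:P) ^+ 2 - (x * y)%:P%:P * ('X * 'X%:P)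
  + (c - (a + b + 1) * y)%:P%:P * 'X%:P - (b * x)%:P%:P * 'X - (a * b)%:P%:P
  = F2sym 'X%:P 'X y%:P%:P x%:P%:P a%:P%:P b%:P%:P c%:P%:P
  :> {poly {poly F}}.
Proof.
rewrite /F2sym !(polyCD, polyCN, polyCM, polyC1).
by rewrite (mulrC x%:P%:P) (mulrC 'X).
Qed.

(** * The Appell equations and their first partial derivatives as symbols *)

Section AppellSystem.
Variables (K : fieldType) (a b1 b2 c1 c2 : K).

Let X : pde K := 'X.
Let Y : pde K := 'X%:P.
Let x : pde K := rat2X%:P%:P.
Let y : pde K := rat2Y%:P%:P.
Let cst (c : K) : pde K := (rat2C c)%:P%:P.

Lemma appellF2_pde1E : appellF2_pde1 a b1 c1 =
  F2sym X Y x y (cst a) (cst b1) (cst c1).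
Proof.
rewrite /appellF2_pde1 (rat2CM a b1) (rat2CD (a + b1)) (rat2CD a b1) rat2C1.
exact: F2sym1_poly.
Qed.

Lemma appellF2_pde2E : appellF2_pde2 a b2 c2 =
  F2sym Y X y x (cst a) (cst b2) (cst c2).
Proof.
rewrite /appellF2_pde2 (rat2CM a b2) (rat2CD (a + b2)) (rat2CD a b2) rat2C1.
exact: F2sym2_poly.
Qed.

Lemma Dx2_derivation : derivation (map_poly (map_poly (@Dx K))).
Proof. exact/map_poly_derivation/map_poly_derivation/Dx_derivation. Qed.
Lemma Dy2_derivation : derivation (map_poly (map_poly (@Dy K))).
Proof. exact/map_poly_derivation/map_poly_derivation/Dy_derivation. Qed.

Lemma pde_Dx_pde1 : pde_Dx (appellF2_pde1 a b1 c1) =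
  F2sym_dx X Y x y (cst a) (cst b1) (cst c1).
Proof.
have dd := Dx_derivation K; rewrite appellF2_pde1E.
apply: (derivation_F2sym_dx Dx2_derivation).
- exact: map_poly2X dd.
- exact: map_poly2Y dd.
- exact: map_poly2C1 dd (Dx_X K).
- exact: map_poly2C0 dd (Dx_Y K).
- exact: map_poly2C0 dd (Dx_C _).
- exact: map_poly2C0 dd (Dx_C _).
- exact: map_poly2C0 dd (Dx_C _).
Qed.

(** In the second equation x is the second variable of [F2sym], whence the form [F2sym_dy] for a
    derivative in x. *)
Lemma pde_Dx_pde2 : pde_Dx (appellF2_pde2 a b2 c2) =
  F2sym_dy Y X y x (cst a) (cst b2) (cst c2).
Proof.
have dd := Dx_derivation K; rewrite appellF2_pde2E.
apply: (derivation_F2sym_dy Dx2_derivation).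
- exact: map_poly2Y dd.
- exact: map_poly2X dd.
- exact: map_poly2C0 dd (Dx_Y K).
- exact: map_poly2C1 dd (Dx_X K).
- exact: map_poly2C0 dd (Dx_C _).
- exact: map_poly2C0 dd (Dx_C _).
- exact: map_poly2C0 dd (Dx_C _).
Qed.

Lemma pde_Dy_pde1 : pde_Dy (appellF2_pde1 a b1 c1) =
  F2sym_dy X Y x y (cst a) (cst b1) (cst c1).
Proof.
have dd := Dy_derivation K; rewrite appellF2_pde1E.
apply: (derivation_F2sym_dy Dy2_derivation).
- exact: map_poly2X dd.
- exact: map_poly2Y dd.
- exact: map_poly2C0 dd (Dy_X K).
- exact: map_poly2C1 dd (Dy_Y K).
- exact: map_poly2C0 dd (Dy_C _).
- exact: map_poly2C0 dd (Dy_C _).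
- exact: map_poly2C0 dd (Dy_C _).
Qed.

Lemma pde_Dy_pde2 : pde_Dy (appellF2_pde2 a b2 c2) =
  F2sym_dx Y X y x (cst a) (cst b2) (cst c2).
Proof.
have dd := Dy_derivation K; rewrite appellF2_pde2E.
apply: (derivation_F2sym_dx Dy2_derivation).
- exact: map_poly2Y dd.
- exact: map_poly2X dd.
- exact: map_poly2C1 dd (Dy_Y K).
- exact: map_poly2C0 dd (Dy_X K).
- exact: map_poly2C0 dd (Dy_C _).
- exact: map_poly2C0 dd (Dy_C _).
- exact: map_poly2C0 dd (Dy_C _).
Qed.

End AppellSystem.

(** * Relations compatible with the ring operations *)

Section RingRelation.
Variables (F G : comNzRingType) (r : F -> G -> Prop).

(** The relational form of a ring morphism: specialization is defined only away from poles, hence is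
    a relation, but it still passes through every ring expression term by term. *)
Record ring_rel : Prop := RingRel {
  ring_rel1 : r 1 1;
  ring_relN : forall u u', r u u' -> r (- u) (- u');
  ring_relD : forall u v u' v', r u u' -> r v v' -> r (u + v) (u' + v');
  ring_relM : forall u v u' v', r u u' -> r v v' -> r (u * v) (u' * v')
}.

(** Applied twice to [spec_ratfun Phi], this is [specialized_form Phi]. *)
Definition poly_rel (p : {poly F}) (q : {poly G}) : Prop :=
  forall i, r p`_i q`_i.

Hypothesis rr : ring_rel.

Lemma ring_rel0 : r 0 0.
Proof.
rewrite -(subrr (1 : F)) -(subrr (1 : G)).
by apply: (ring_relD rr) (ring_relN rr _); exact: ring_rel1.
Qed.

Lemma ring_rel_sum (I : Type) (s : seq I) (f : I -> F) (g : I -> G) :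
  (forall i, r (f i) (g i)) -> r (\sum_(i <- s) f i) (\sum_(i <- s) g i).
Proof.
move=> h; apply: (big_rec2 r); first exact: ring_rel0.
by move=> i u v _; apply: ring_relD.
Qed.

Lemma poly_relC u v : r u v -> poly_rel u%:P v%:P.
Proof. by move=> h i; rewrite !coefC; case: eqP => _ //; exact: ring_rel0. Qed.

Lemma poly_relX : poly_rel 'X 'X.
Proof.
move=> i; rewrite !coefX; case: eqP => _; first exact: ring_rel1.
exact: ring_rel0.
Qed.

Lemma ring_rel_F2sym X Y x y a b c X' Y' x' y' a' b' c' :
  r X X' -> r Y Y' -> r x x' -> r y y' -> r a a' -> r b b' -> r c c' ->
  [/\ r (F2sym X Y x y a b c) (F2sym X' Y' x' y' a' b' c'),
      r (F2sym_dx X Y x y a b c) (F2sym_dx X' Y' x' y' a' b' c')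
    & r (F2sym_dy X Y x y a b c) (F2sym_dy X' Y' x' y' a' b' c')].
Proof.
move=> *; rewrite /F2sym_dx /F2sym_dy /F2sym !expr2; split;
by repeat first [ assumption | exact: (ring_rel1 rr)
  | apply: (ring_relD rr) | apply: (ring_relN rr) | apply: (ring_relM rr) ].
Qed.

End RingRelation.

Lemma poly_rel_ring_rel (F G : comNzRingType) (r : F -> G -> Prop) :
  ring_rel r -> ring_rel (poly_rel r).
Proof.
move=> rr; split=> [|u u' h|u v u' v' h h'|u v u' v' h h'].
- rewrite -[1 in X in poly_rel _ X _]polyC1 -[1 in X in poly_rel _ _ X]polyC1.
  exact: poly_relC (ring_rel1 rr).
- by move=> i; rewrite !coefN; apply: ring_relN.
- by move=> i; rewrite !coefD; apply: ring_relD.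
- move=> i; rewrite !coefM; apply: ring_rel_sum => // k.
  exact: ring_relM.
Qed.

(** * Specialization to a curve respects the ring operations *)

Section Specialization.
Variables (K : fieldType) (Phi : {poly K} * {poly K}).

Lemma spec_polyD p q :
  spec_poly Phi (p + q) = spec_poly Phi p + spec_poly Phi q.
Proof.
by rewrite /spec_poly (rmorphD (map_poly (comp_poly Phi.2))) hornerD.
Qed.

Lemma spec_polyM p q :
  spec_poly Phi (p * q) = spec_poly Phi p * spec_poly Phi q.
Proof.
by rewrite /spec_poly (rmorphM (map_poly (comp_poly Phi.2))) hornerM.
Qed.

Lemma spec_polyCp q : spec_poly Phi q%:P = q \Po Phi.2.
Proof. by rewrite /spec_poly (map_polyC (comp_poly Phi.2)) hornerC. Qed.

Lemma spec_polyC c : spec_poly Phi c%:P%:P = c%:P.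
Proof. by rewrite spec_polyCp comp_polyC. Qed.

Lemma spec_polyX : spec_poly Phi 'X = Phi.1.
Proof. by rewrite /spec_poly (map_polyX (comp_poly Phi.2)) hornerX. Qed.

Lemma spec_poly1 : spec_poly Phi 1 = 1.
Proof. by rewrite -polyC1 -polyC1 spec_polyC. Qed.

Lemma spec_ratfun_poly p : spec_ratfun Phi p%:F (spec_poly Phi p)%:F.
Proof.
by exists p, 1; rewrite spec_poly1 oner_eq0 !tofrac1 !divr1.
Qed.

Lemma spec_ratfunD f g f' g' : spec_ratfun Phi f f' -> spec_ratfun Phi g g' ->
  spec_ratfun Phi (f + g) (f' + g').
Proof.
(* Since 0 specializes to 0, a denominator that survives specialization was nonzero in two
   variables. *)
have nz m : spec_poly Phi m != 0 -> m != 0.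
  by apply: contraNneq => ->; rewrite -polyC0 -polyC0 spec_polyC.
case=> n [m [m0 -> ->]] [n' [m' [m0' -> ->]]].
exists (n * m' + n' * m), (m * m'); split.
- by rewrite spec_polyM mulf_neq0.
- by rewrite addf_div ?tofrac_eq0 ?nz // -!tofracM -tofracD.
- by rewrite addf_div ?tofrac_eq0 // -!tofracM -tofracD spec_polyD !spec_polyM.
Qed.

Lemma spec_ratfunM f g f' g' : spec_ratfun Phi f f' -> spec_ratfun Phi g g' ->
  spec_ratfun Phi (f * g) (f' * g').
Proof.
case=> n [m [m0 -> ->]] [n' [m' [m0' -> ->]]].
exists (n * n'), (m * m'); split.
- by rewrite spec_polyM mulf_neq0.
- by rewrite mulf_div -!tofracM.
- by rewrite mulf_div -!tofracM !spec_polyM.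
Qed.

Lemma spec_ratfun1 : spec_ratfun Phi 1 1.
Proof. by have := spec_ratfun_poly 1; rewrite spec_poly1 !tofrac1. Qed.

Lemma spec_ratfun_C c : spec_ratfun Phi (rat2C c) (rat1C c).
Proof. by have := spec_ratfun_poly c%:P%:P; rewrite spec_polyC. Qed.

Lemma spec_ratfunN f g : spec_ratfun Phi f g -> spec_ratfun Phi (- f) (- g).
Proof.
move=> h; have := spec_ratfunM (spec_ratfun_C (-1)) h.
by rewrite rat1CN rat2CN rat1C1 rat2C1 !mulN1r.
Qed.

Lemma spec_ratfun_ring_rel : ring_rel (spec_ratfun Phi).
Proof.
split; [exact: spec_ratfun1 | exact: spec_ratfunN | |].
  exact: spec_ratfunD.
exact: spec_ratfunM.
Qed.

Lemma specialized_form_ring_rel : ring_rel (specialized_form Phi).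
Proof.
exact: (poly_rel_ring_rel (poly_rel_ring_rel spec_ratfun_ring_rel)).
Qed.

Lemma specialized_formC f g : spec_ratfun Phi f g ->
  specialized_form Phi f%:P%:P g%:P%:P.
Proof.
have rr := spec_ratfun_ring_rel.
move=> h; exact: (poly_relC (poly_rel_ring_rel rr) (poly_relC rr h)).
Qed.

Lemma specialized_formX : specialized_form Phi 'X 'X.
Proof. exact: (poly_relX (poly_rel_ring_rel spec_ratfun_ring_rel)). Qed.

Lemma specialized_formY : specialized_form Phi 'X%:P 'X%:P.
Proof.
have rr := spec_ratfun_ring_rel.
exact: (poly_relC (poly_rel_ring_rel rr) (poly_relX rr)).
Qed.

Lemma specialized_form_x : specialized_form Phi rat2X%:P%:P Phi.1%:F%:P%:P.
Proof.
apply: specialized_formC; rewrite -[Phi.1]spec_polyX; exact: spec_ratfun_poly.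
Qed.

Lemma specialized_form_y : specialized_form Phi rat2Y%:P%:P Phi.2%:F%:P%:P.
Proof.
apply: specialized_formC.
have := spec_ratfun_poly 'X%:P; by rewrite spec_polyCp comp_polyX.
Qed.

Lemma specialized_form_cst c :
  specialized_form Phi (rat2C c)%:P%:P (rat1C c)%:P%:P.
Proof. exact/specialized_formC/spec_ratfun_C. Qed.

End Specialization.

(** * Operators of order at most three, by their coefficients *)

Section Cubic.
Variable F : nzRingType.
Implicit Types c e : F.

(** [Poly] drops trailing zeros, so [c3 = 0] is allowed and the second-order equation of (i) is
    covered as well. *)
Definition cubic c0 c1 c2 c3 : {poly F} := Poly [:: c0; c1; c2; c3].

Lemma cubicE c0 c1 c2 c3 :
  c3 *: 'X^3 + c2 *: 'X^2 + c1 *: 'X - c0%:P = cubic (- c0) c1 c2 c3.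
Proof.
apply/polyP => i; rewrite coef_Poly coefB !coefD !coefZ !coefXn coefX coefC.
by case: i => [|[|[|[|i]]]] /=;
  rewrite ?nth_nil !(mulr0, mulr1, add0r, addr0, subr0, sub0r).
Qed.

Lemma cubicD c0 c1 c2 c3 e0 e1 e2 e3 :
  cubic c0 c1 c2 c3 + cubic e0 e1 e2 e3
  = cubic (c0 + e0) (c1 + e1) (c2 + e2) (c3 + e3).
Proof.
apply/polyP => i; rewrite coefD !coef_Poly.
by case: i => [|[|[|[|i]]]] //=; rewrite nth_nil addr0.
Qed.

Lemma cubicZ f c0 c1 c2 c3 :
  f *: cubic c0 c1 c2 c3 = cubic (f * c0) (f * c1) (f * c2) (f * c3).
Proof.
apply/polyP => i; rewrite coefZ !coef_Poly.
by case: i => [|[|[|[|i]]]] //=; rewrite nth_nil mulr0.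
Qed.

Lemma cubic1 : cubic 1 0 0 0 = 1.
Proof.
apply/polyP => i; rewrite coef_Poly coef1.
by case: i => [|[|[|[|i]]]] //=; rewrite nth_nil.
Qed.

Lemma size_cubic3 c0 c1 c2 c3 : c3 != 0 -> size (cubic c0 c1 c2 c3) = 4.
Proof. by move=> h; rewrite (PolyK (c := 0)). Qed.

Lemma size_cubic2 c0 c1 c2 : c2 != 0 -> size (cubic c0 c1 c2 0) = 3.
Proof.
move=> h; have -> : cubic c0 c1 c2 0 = Poly [:: c0; c1; c2].
  apply/polyP => i; rewrite !coef_Poly.
  by case: i => [|[|[|[|i]]]] //=; rewrite nth_nil.
by rewrite (PolyK (c := 0)).
Qed.

(** The sums that transform an operator run up to its size, which depends on which coefficients
    vanish. As a zero coefficient contributes nothing, four terms always serve. *)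
Lemma sum_cubic (V : nmodType) (G : F -> nat -> V) c0 c1 c2 c3 :
  (forall k, G 0 k = 0) ->
  \sum_(k < size (cubic c0 c1 c2 c3)) G (cubic c0 c1 c2 c3)`_k k
  = G c0 0 + G c1 1 + G c2 2 + G c3 3.
Proof.
move=> G0; set p := cubic _ _ _ _.
have sp : (size p <= 4)%N by exact: size_Poly.
transitivity (\sum_(k < 4) G p`_k k).
  rewrite (big_ord_widen 4 (fun k => G p`_k k) sp) big_mkcond /=.
  apply: eq_bigr => k _; case: ltnP => // h.
  by rewrite (nth_default _ h) G0.
by rewrite !big_ord_recr big_ord0 /= add0r !coef_Poly.
Qed.

End Cubic.

(** * Change of variable and multiplication of solutions *)

Section CubicOperators.
Variables (F : fieldType) (d : F -> F).
Hypothesis dd : derivation d.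

(* d o L, for an operator L of order at most 2. *)
Lemma comp_d_cubic (c0 c1 c2 : F) :
  map_poly d (cubic c0 c1 c2 0) + 'X * cubic c0 c1 c2 0
  = cubic (d c0) (d c1 + c0) (d c2 + c1) c2.
Proof.
apply/polyP => i; rewrite coefD (coef_map_derivation dd) coefXM !coef_Poly.
case: i => [|[|[|[|[|i]]]]] //=; rewrite ?(derivation0 dd) ?addr0 ?add0r //.
by rewrite nth_nil.
Qed.

(** For T = w d one has T^2 = w^2 d^2 + w w' d and T^3 = w^3 d^3 + 3 w^2 w' d^2 + w (w'^2 + w w'')
    d. *)
Lemma pullback_cubic (w w' w'' g0 g1 g2 g3 : F) :
  d w = w' -> d w' = w'' ->
  let T := fun M => w *: (map_poly d M + 'X * M) in
  g0 *: iter 0 T 1 + g1 *: iter 1 T 1 + g2 *: iter 2 T 1 + g3 *: iter 3 T 1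
  = cubic g0 (g1 * w + g2 * (w * w') + g3 * (w * (w' ^+ 2 + w * w'')))
      (g2 * w ^+ 2 + g3 * (3%:R * w ^+ 2 * w')) (g3 * w ^+ 3).
Proof.
move=> dw dw' T; rewrite -(cubic1 F) /= /T.
rewrite !(comp_d_cubic, cubicZ, derivation0 dd, derivation1 dd, mulr0, mulr1,
  addr0, add0r).
rewrite !(derivationD dd, derivationM dd, dw, dw') !cubicD.
by congr cubic; ring.
Qed.

(** For T = d - l one has T^2 = d^2 - 2 l d + (l^2 - l') and T^3 = d^3 - 3 l d^2 + 3 (l^2 - l') d +
    (3 l l' - l'' - l^3). *)
Lemma mulsol_cubic (l l' l'' c0 c1 c2 c3 : F) :
  d l = l' -> d l' = l'' ->
  let T := fun M => map_poly d M + 'X * M - l *: M in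
  c0 *: iter 0 T 1 + c1 *: iter 1 T 1 + c2 *: iter 2 T 1 + c3 *: iter 3 T 1
  = cubic (c0 - c1 * l + c2 * (l ^+ 2 - l')
           + c3 * (3%:R * l * l' - l'' - l ^+ 3))
      (c1 - 2%:R * c2 * l + 3%:R * c3 * (l ^+ 2 - l'))
      (c2 - 3%:R * c3 * l) c3.
Proof.
move=> dl dl' T; rewrite -(cubic1 F) /= /T -!scaleNr.
rewrite !(comp_d_cubic, cubicZ, cubicD, derivation0 dd, derivation1 dd, mulr0,
  mulr1, addr0, add0r, mulN1r).
rewrite !(derivationD dd, derivationN dd, derivationM dd, dl, dl').
by congr cubic; ring.
Qed.

Lemma derivationV u : u != 0 -> d u^-1 = - (d u / u ^+ 2).
Proof.
move=> u0; apply: (mulfI u0); apply: (addrI (d u * u^-1)).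
rewrite -(derivationM dd) divff // (derivation1 dd).
by field.
Qed.

Variables (x a : F).
Hypotheses (dx : d x = 1) (da : d a = 0) (x1 : x - 1 != 0).

Lemma d_sub1 : d (x - 1) = 1.
Proof. by rewrite (derivationB dd) dx (derivation1 dd) subr0. Qed.

Lemma d_moebius : d (x / (x - 1)) = - (x - 1) ^- 2.
Proof.
rewrite (derivationM dd) dx derivationV // d_sub1.
by field.
Qed.

(* p, q, r, s, t are the parameter expressions D + E + 1, A + B + C + 3,
   AB + AC + BC + A + B + C + 1, DE and ABC of the 3F2 equation. *)
Lemma moebius_mulsol_cubic (p q r s t : F) :
  let z := x / (x - 1) in
  let w := (- (x - 1) ^- 2)^-1 in
  let l := - a * (-1 / (1 - x)) in
  let T := fun M => w *: (map_poly d M + 'X * M) in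
  let T' := fun M => map_poly d M + 'X * M - l *: M in
  exists c0 c1 c2 c3,
   (- t) *: iter 0 T 1 + (s - r * z) *: iter 1 T 1
     + (z * (p - q * z)) *: iter 2 T 1 + (z ^+ 2 * (1 - z)) *: iter 3 T 1
    = cubic c0 c1 c2 c3
  /\ c0 *: iter 0 T' 1 + c1 *: iter 1 T' 1 + c2 *: iter 2 T' 1
       + c3 *: iter 3 T' 1 =
    cubic
     (- t + a * (6%:R * x ^+ 2 + 2%:R * x * (p * (x - 1) - q * x)
                 - s * (x - 1) + r * x)
      + (a ^+ 2 - a) * (6%:R * x ^+ 2 + x * (p * (x - 1) - q * x))
      + (a ^+ 3 - 3%:R * a ^+ 2 + 2%:R * a) * x ^+ 2)
     ((x - 1) * (6%:R * x ^+ 2 + 2%:R * x * (p * (x - 1) - q * x)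
                 - s * (x - 1) + r * x
      + 2%:R * a * (6%:R * x ^+ 2 + x * (p * (x - 1) - q * x))
      + 3%:R * (a ^+ 2 - a) * x ^+ 2))
     ((x - 1) ^+ 2 * (6%:R * x ^+ 2 + x * (p * (x - 1) - q * x)
                 + 3%:R * a * x ^+ 2))
     (x ^+ 2 * (x - 1) ^+ 3).
Proof.
move=> z w l T T'.
have x1' : 1 - x != 0 by rewrite -opprB oppr_eq0.
(* The inverse of dz/dx is a polynomial in x, and so are the derivatives of w that [pullback_cubic]
   takes. *)
have wE : w = - (x - 1) ^+ 2 by rewrite /w invrN invrK.
have d2 : d 2%:R = 0 by rewrite (derivationD dd) (derivation1 dd) addr0.
have dw : d w = - (2%:R * (x - 1)).
  by rewrite wE (derivationN dd) expr2 (derivationM dd) d_sub1; ring.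
have dw' : d (- (2%:R * (x - 1))) = - 2%:R.
  by rewrite (derivationN dd) (derivationM dd) d_sub1 d2; ring.
have lE : l = - (a * (x - 1)^-1).
  by rewrite /l; field; rewrite x1 x1'.
have dl : d l = a * ((x - 1)^-1 * (x - 1)^-1).
  rewrite lE (derivationN dd) (derivationM dd) da derivationV // d_sub1.
  by field.
have dl' : d (a * ((x - 1)^-1 * (x - 1)^-1)) = - (2%:R * a / (x - 1) ^+ 3).
  rewrite !(derivationM dd) da derivationV // d_sub1.
  by field.
rewrite (pullback_cubic _ _ _ _ dw dw').
(* The intermediate coefficients are whatever [pullback_cubic] yields; a closed form is wanted only
   after the second transformation. *)
eexists _, _, _, _; split; first by [].
rewrite (mulsol_cubic _ _ _ _ dl dl') lE wE /z.
by congr cubic; field.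
Qed.

End CubicOperators.

(** * Substitution of a nonconstant function into polynomials and fractions *)

Section Evaluation.
Variables (K F : fieldType) (f : {rmorphism K -> F}) (d : F -> F).
Hypotheses (dd : derivation d) (df : forall c, d (f c) = 0).

Lemma derivation_horner_map (phi : F) (p : {poly K}) :
  d (map_poly f p).[phi] = (map_poly f p^`()).[phi] * d phi.
Proof.
elim/poly_ind: p => [|p c IHp].
  by rewrite deriv0 rmorph0 horner0 (derivation0 dd) mul0r.
rewrite derivD derivC addr0 derivM derivX mulr1 !rmorphD !rmorphM /=.
rewrite map_polyC map_polyX !hornerE (derivationD dd) (derivationM dd) IHp df.
by ring.
Qed.

(* A relation of least degree satisfied by phi could be differentiated. *)
Lemma horner_map_neq0 (phi : F) (p : {poly K}) : [pchar K] =i pred0 ->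
  d phi != 0 -> p != 0 -> (map_poly f p).[phi] != 0.
Proof.
move=> /pcharf0P chK dphi.
have [n] := ubnP (size p); elim: n p => // n IHn p sp p0.
have [sp1|sp1] := leqP (size p) 1.
  have pE := size1_polyC sp1; rewrite pE polyC_eq0 in p0.
  by rewrite pE map_polyC hornerC fmorph_eq0.
apply/eqP => pphi0.
(* The coefficient of index [(size p).-2] of the derivative is the degree of p times its leading
   coefficient, nonzero in characteristic 0. *)
have p'0 : p^`() != 0.
  apply/eqP => /polyP /(_ (size p).-2).
  rewrite coef_deriv coef0 prednK; last by case: (size p) sp1 => [|[]].
  move/eqP; rewrite -mulr_natr mulf_eq0 chK -lead_coefE lead_coef_eq0.
  by rewrite (negPf p0); case: (size p) sp1 => [|[]].
have := IHn _ (leq_trans (lt_size_deriv p0) sp) p'0.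
have /eqP := derivation_horner_map phi p.
by rewrite pphi0 (derivation0 dd) eq_sym mulf_eq0 (negPf dphi) orbF => ->.
Qed.

End Evaluation.

(** Meant for f the embedding of polynomials into fractions and g the evaluation at phi: the
    relation is then substitution restricted to polynomials. *)
Lemma rmorphism_pair_rel (R F G : comNzRingType) (f : {rmorphism R -> F})
    (g : {rmorphism R -> G}) :
  ring_rel (fun u v => exists p, u = f p /\ v = g p).
Proof.
split.
- by exists 1; rewrite !rmorph1.
- by move=> _ _ [p [-> ->]]; exists (- p); rewrite !rmorphN.
- by move=> _ _ _ _ [p [-> ->]] [q [-> ->]]; exists (p + q); rewrite !rmorphD.
- by move=> _ _ _ _ [p [-> ->]] [q [-> ->]]; exists (p * q); rewrite !rmorphM.
Qed.

Lemma ring_rel_nat (F G : comNzRingType) (r : F -> G -> Prop) n :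
  ring_rel r -> r n%:R n%:R.
Proof.
move=> rr; elim: n => [|n IHn]; first exact: ring_rel0.
by rewrite !mulrS; apply: (ring_relD rr) IHn; exact: ring_rel1.
Qed.

Lemma ring_rel_3F2 (F G : comNzRingType) (r : F -> G -> Prop)
    A B C D E x A' B' C' D' E' x' : ring_rel r ->
  r A A' -> r B B' -> r C C' -> r D D' -> r E E' -> r x x' ->
  [/\ r (- (A * B * C)) (- (A' * B' * C')),
      r (D * E - (A * B + A * C + B * C + A + B + C + 1) * x)
        (D' * E' - (A' * B' + A' * C' + B' * C' + A' + B' + C' + 1) * x'),
      r (x * (D + E + 1 - (A + B + C + 3%:R) * x))
        (x' * (D' + E' + 1 - (A' + B' + C' + 3%:R) * x'))
    & r (x ^+ 2 * (1 - x)) (x' ^+ 2 * (1 - x'))].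
Proof.
move=> rr *; have r3 := ring_rel_nat 3 rr; rewrite !expr2; split;
by repeat first [ assumption | exact: (ring_rel1 rr)
  | apply: (ring_relD rr) | apply: (ring_relN rr) | apply: (ring_relM rr) ].
Qed.

Section Composition.
Variable K : fieldType.
Hypothesis charK : [pchar K] =i pred0.

Fact rat1C_is_zmod_morphism : zmod_morphism (@rat1C K).
Proof. by move=> c e; rewrite rat1CD rat1CN. Qed.
Fact rat1C_is_monoid_morphism : monoid_morphism (@rat1C K).
Proof. by split; [exact: rat1C1 | exact: rat1CM]. Qed.
HB.instance Definition _ :=
  GRing.isZmodMorphism.Build K (ratfun1 K) (@rat1C K) rat1C_is_zmod_morphism.
HB.instance Definition _ :=
  GRing.isMonoidMorphism.Build K (ratfun1 K) (@rat1C K)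
    rat1C_is_monoid_morphism.

(** The chosen representative of p is some n / m with n = p m. As phi is not constant, m does not
    vanish at phi and cancels. *)
Lemma ratfun_comp_poly (p : {poly K}) (phi : ratfun1 K) : Dt phi != 0 ->
  ratfun_comp p%:F phi = (map_poly (@rat1C K) p).[phi].
Proof.
move=> dphi; rewrite /ratfun_comp.
have := frac_repr p%:F; have := denom_ratioP (repr p%:F).
move: (\n_(repr p%:F)) (\d_(repr p%:F)) => n m m0 E.
have mphi0 : (map_poly (@rat1C K) m).[phi] != 0.
  exact: (horner_map_neq0 (Dt_derivation K) (@Dt_C K)).
have -> : n = p * m.
  have m0F : m%:F != 0 by rewrite tofrac_eq0.
  apply/eqP; rewrite -tofrac_eq; apply/eqP.
  by rewrite tofracM E; exact: esym (divfK m0F _).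
by rewrite (rmorphM (map_poly (@rat1C K))) hornerM mulfK.
Qed.

(** The coefficients of hypergeometric equations are polynomials, so substitution has to be followed
    only on polynomials, where it is a ring morphism. *)
Lemma ratfun_comp_rel (phi : ratfun1 K) : Dt phi != 0 ->
  exists r : ratfun1 K -> ratfun1 K -> Prop,
  [/\ ring_rel r, forall c, r (rat1C c) (rat1C c), r rat1X phi
    & forall u v, r u v -> ratfun_comp u phi = v].
Proof.
move=> dphi; pose ev := horner_eval phi \o map_poly (@rat1C K).
exists (fun u v => exists p, u = p%:F /\ v = ev p); split.
- exact: rmorphism_pair_rel.
- by move=> c; exists c%:P; rewrite /ev /= map_polyC /horner_eval hornerC.
- by exists 'X; rewrite /ev /= map_polyX /horner_eval hornerX.
- by move=> _ _ [p [-> ->]]; exact: ratfun_comp_poly.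
Qed.

End Composition.

(** * Partial differential forms along lines *)

Section ChainRule.
Variables (F : comNzRingType) (d : F -> F) (e : F).
Hypotheses (dd : derivation d) (de : d e = 0).

Lemma derivation_exp (A : comNzRingType) (D : A -> A) (u : A) k :
  derivation D -> D u = 0 -> D (u ^+ k) = 0.
Proof.
move=> dD du; elim: k => [|k IHk]; first by rewrite (derivation1 dD).
by rewrite exprS (derivationM dD) du IHk mul0r mulr0 addr0.
Qed.

(** Each of the three curves is a line of constant velocity (1, e). Then d/dt has the constant
    symbol X + e Y, the derivation of coefficients kills its powers, and iterating the chain rule
    amounts to taking powers. *)
Lemma iter_chain k :
  iter k (fun Q : {poly {poly F}} => map_poly (map_poly d) Q
            + 1%:P%:P * ('X * Q) + e%:P%:P * ('X%:P * Q)) 1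
  = ('X + e%:P%:P * 'X%:P) ^+ k.
Proof.
have d2 := map_poly_derivation (map_poly_derivation dd).
elim: k => //= k ->; rewrite (derivation_exp _ d2); last first.
  rewrite (derivationD d2) (derivationM d2) map_poly2X // map_poly2Y //.
  by rewrite (map_poly2C0 dd de) mul0r mulr0 !addr0.
by rewrite !polyC1 add0r mul1r exprS mulrDl mulrA.
Qed.

End ChainRule.

Lemma partial_form_cubic (K : fieldType) (Phi : {poly K} * {poly K})
    (e c0 c1 c2 c3 : ratfun1 K) :
  Dt Phi.1%:F = 1 -> Dt Phi.2%:F = e -> Dt e = 0 ->
  let D := 'X + e%:P%:P * 'X%:P in
  partial_form Phi (cubic c0 c1 c2 c3)
  = c0%:P%:P * D ^+ 0 + c1%:P%:P * D ^+ 1 + c2%:P%:P * D ^+ 2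
    + c3%:P%:P * D ^+ 3.
Proof.
move=> d1 d2 de D; rewrite /partial_form /chain_Dt d1 d2.
pose G (c : ratfun1 K) k : {poly {poly ratfun1 K}} := c%:P%:P * D ^+ k.
rewrite -[RHS](@sum_cubic _ _ G); last by move=> k; rewrite /G !polyC0 mul0r.
by apply: eq_bigr => k _; rewrite (iter_chain (Dt_derivation K) de).
Qed.

(** * The eliminations as identities between commutative polynomials *)

Section Identities.
Variable F : comNzRingType.
Implicit Types (x a b c e t : F).

Lemma F2_y0_identity x a b1 c1 :
  let D : {poly {poly F}} := 'X + 0%:P%:P * 'X%:P in
  F2sym 'X 'X%:P x%:P%:P 0%:P%:P a%:P%:P b1%:P%:P c1%:P%:P
  = (- (a * b1))%:P%:P * D ^+ 0 + (c1 - (a + b1 + 1) * x)%:P%:P * D ^+ 1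
    + (x * (1 - x))%:P%:P * D ^+ 2 + 0%:P%:P * D ^+ 3.
Proof. by move=> D; rewrite /D /F2sym; ring. Qed.

(** The left side is (theta + e) P1 - (theta + b1) P2 at y = 1, with [E] for e. Composites with d/dx
    are already expanded, so [ring] can decide the identity although operators do not commute. *)
Lemma F2_y1_identity x a b1 b2 c1 c2 :
  let X : {poly {poly F}} := 'X in let Y : {poly {poly F}} := 'X%:P in
  let D := X + 0%:P%:P * Y in let k (c : F) := c%:P%:P in
  let C := a - c2 + 1 in let E := a + b2 - c2 + 1 in
  k x * F2sym_dx X Y (k x) (k 1) (k a) (k b1) (k c1)
  + k E * F2sym X Y (k x) (k 1) (k a) (k b1) (k c1)
  - (k x * F2sym_dy Y X (k 1) (k x) (k a) (k b2) (k c2)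
     + k b1 * F2sym Y X (k 1) (k x) (k a) (k b2) (k c2))
  = k (- (a * b1 * C)) * D ^+ 0
    + k (c1 * E - (a * b1 + a * C + b1 * C + a + b1 + C + 1) * x) * D ^+ 1
    + k (x * ((c1 + E + 1) - (a + b1 + C + 3%:R) * x)) * D ^+ 2
    + k (x ^+ 2 * (1 - x)) * D ^+ 3.
Proof.
by move=> X Y D k C E; rewrite /D /k /C /E /F2sym_dx /F2sym_dy /F2sym; ring.
Qed.

(** Here [T] is the combination free of F_x, with D o P expanded as d/dx o P - d/dy o P. It begins
    with x^2 (x - 1)^2 D^3, and the factor x - 1 brings it to the coefficients produced by
    [moebius_mulsol_cubic]. *)
Lemma F2_y1x_identity x a b1 b2 c1 c2 :
  let X : {poly {poly F}} := 'X in let Y : {poly {poly F}} := 'X%:P in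
  let D := X + (-1)%:P%:P * Y in let k (c : F) := c%:P%:P in
  let B := c1 - b1 in let C := a - c2 + 1 in
  let E := a + b2 - c2 + 1 in
  let p := c1 + E + 1 in let q := a + B + C + 3%:R in
  let r := a * B + a * C + B * C + a + B + C + 1 in
  let P1 := F2sym X Y (k x) (k (1 - x)) (k a) (k b1) (k c1) in
  let P2 := F2sym Y X (k (1 - x)) (k x) (k a) (k b2) (k c2) in
  let T :=
    k x * (k (1 - x) *
      (F2sym_dx X Y (k x) (k (1 - x)) (k a) (k b1) (k c1)
       + F2sym_dy Y X (k (1 - x)) (k x) (k a) (k b2) (k c2)
       - (F2sym_dy X Y (k x) (k (1 - x)) (k a) (k b1) (k c1)
          + F2sym_dx Y X (k (1 - x)) (k x) (k a) (k b2) (k c2))))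
    - k (c1 + c2 - a - b1 - b2 - 1) * P1
    + (k (c1 - b1) * (P1 + P2) - k (a + 1) * (k x * (P1 + P2))) in
  k x * T - T
  = k (- (a * B * C) + a * (6%:R * x ^+ 2 + 2%:R * x * (p * (x - 1) - q * x)
                 - c1 * E * (x - 1) + r * x)
      + (a ^+ 2 - a) * (6%:R * x ^+ 2 + x * (p * (x - 1) - q * x))
      + (a ^+ 3 - 3%:R * a ^+ 2 + 2%:R * a) * x ^+ 2) * D ^+ 0
    + k ((x - 1) * (6%:R * x ^+ 2 + 2%:R * x * (p * (x - 1) - q * x)
                 - c1 * E * (x - 1) + r * x
      + 2%:R * a * (6%:R * x ^+ 2 + x * (p * (x - 1) - q * x))
      + 3%:R * (a ^+ 2 - a) * x ^+ 2)) * D ^+ 1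
    + k ((x - 1) ^+ 2 * (6%:R * x ^+ 2 + x * (p * (x - 1) - q * x)
                 + 3%:R * a * x ^+ 2)) * D ^+ 2
    + k (x ^+ 2 * (x - 1) ^+ 3) * D ^+ 3.
Proof.
move=> X Y D k B C E p q r P1 P2 T.
rewrite /T /P1 /P2 /r /q /p /E /C /B /D /k /F2sym_dx /F2sym_dy /F2sym; ring.
Qed.

End Identities.

(** * The three specializations *)

Section Specializations.
Variables (K : fieldType) (a b1 b2 c1 c2 : K).

Let H := appellF2_system a b1 b2 c1 c2.
Let P1 := appellF2_pde1 a b1 c1.
Let P2 := appellF2_pde2 a b2 c2.
Let k (f : ratfun1 K) : {poly {poly ratfun1 K}} := f%:P%:P.
Let x : ratfun1 K := rat1X.

Lemma pde_followsB P Q : pde_follows H P -> pde_follows H Q ->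
  pde_follows H (P - Q).
Proof.
move=> hP hQ; apply: (PdeAdd hP).
have := PdeMul (rat2C (-1)) hQ.
by rewrite rat2CN rat2C1 !polyCN !polyC1 mulN1r.
Qed.

Lemma pde1_follows : pde_follows H P1.
Proof. by apply: PdeGen; exact: mem_head. Qed.

Lemma pde2_follows : pde_follows H P2.
Proof. by apply: PdeGen; rewrite in_cons mem_head orbT. Qed.

Section Along.
Variables (Phi : {poly K} * {poly K}) (y : ratfun1 K).
Hypotheses (Phi_x : Phi.1 = 'X) (Phi_y : Phi.2%:F = y).

Lemma spec_x : specialized_form Phi rat2X%:P%:P (k x).
Proof. by have := specialized_form_x Phi; rewrite Phi_x. Qed.

Lemma spec_y : specialized_form Phi rat2Y%:P%:P (k y).
Proof. by have := specialized_form_y Phi; rewrite Phi_y. Qed.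

Let c' c := k (rat1C c).

Lemma spec_pde1 :
  [/\ specialized_form Phi P1
        (F2sym 'X 'X%:P (k x) (k y) (c' a) (c' b1) (c' c1)),
      specialized_form Phi (pde_Dx P1)
        (F2sym_dx 'X 'X%:P (k x) (k y) (c' a) (c' b1) (c' c1))
    & specialized_form Phi (pde_Dy P1)
        (F2sym_dy 'X 'X%:P (k x) (k y) (c' a) (c' b1) (c' c1))].
Proof.
rewrite pde_Dx_pde1 pde_Dy_pde1 /P1 appellF2_pde1E.
apply: (ring_rel_F2sym (specialized_form_ring_rel Phi)).
- exact: specialized_formX.
- exact: specialized_formY.
- exact: spec_x.
- exact: spec_y.
- exact: specialized_form_cst.
- exact: specialized_form_cst.
- exact: specialized_form_cst.
Qed.

Lemma spec_pde2 :
  [/\ specialized_form Phi P2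
        (F2sym 'X%:P 'X (k y) (k x) (c' a) (c' b2) (c' c2)),
      specialized_form Phi (pde_Dy P2)
        (F2sym_dx 'X%:P 'X (k y) (k x) (c' a) (c' b2) (c' c2))
    & specialized_form Phi (pde_Dx P2)
        (F2sym_dy 'X%:P 'X (k y) (k x) (c' a) (c' b2) (c' c2))].
Proof.
rewrite pde_Dx_pde2 pde_Dy_pde2 /P2 appellF2_pde2E.
apply: (ring_rel_F2sym (specialized_form_ring_rel Phi)).
- exact: specialized_formY.
- exact: specialized_formX.
- exact: spec_y.
- exact: spec_x.
- exact: specialized_form_cst.
- exact: specialized_form_cst.
- exact: specialized_form_cst.
Qed.

End Along.

Lemma rat1X_neq0 : x != 0.
Proof. by rewrite /x /rat1X tofrac_eq0 polyX_eq0. Qed.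

Lemma rat1X_sub1_neq0 : x - 1 != 0.
Proof.
by rewrite /x /rat1X -tofrac1 -tofracB tofrac_eq0 -polyC1 polyXsubC_eq0.
Qed.

Lemma rat1X_1sub_neq0 : 1 - x != 0.
Proof. by rewrite -oppr_eq0 opprB rat1X_sub1_neq0. Qed.

Lemma ode_2F1_cubic A B C : ode_2F1 A B C =
  cubic (- (rat1C A * rat1C B)) (rat1C C - (rat1C A + rat1C B + 1) * x)
    (x * (1 - x)) 0.
Proof.
rewrite -cubicE scale0r add0r /ode_2F1 (rat1CM A B) (rat1CD (A + B)).
by rewrite (rat1CD A B) rat1C1.
Qed.

Lemma ode_3F2_cubic A B C D E :
  let A' := rat1C A in let B' := rat1C B in let C' := rat1C C in
  let D' := rat1C D in let E' := rat1C E in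
  ode_3F2 A B C D E =
  cubic (- (A' * B' * C'))
    (D' * E' - (A' * B' + A' * C' + B' * C' + A' + B' + C' + 1) * x)
    (x * (D' + E' + 1 - (A' + B' + C' + 3%:R) * x)) (x ^+ 2 * (1 - x)).
Proof.
move=> A' B' C' D' E'; rewrite -cubicE /ode_3F2.
have -> : rat1C (A * B * C) = A' * B' * C' by rewrite !rat1CM.
have -> : rat1C (D * E) = D' * E' by rewrite rat1CM.
have -> : rat1C (A * B + A * C + B * C + A + B + C + 1) =
    A' * B' + A' * C' + B' * C' + A' + B' + C' + 1.
  by rewrite !(rat1CD, rat1CM, rat1C1).
have -> : rat1C (D + E + 1) = D' + E' + 1 by rewrite !(rat1CD, rat1C1).
have -> // : rat1C (A + B + C + 3%:R) = A' + B' + C' + 3%:R.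
by rewrite (rat1CD (A + B + C)) (rmorph_nat (@rat1C K)) !rat1CD.
Qed.

Lemma Dt_polyX : Dt ('X : {poly K})%:F = 1.
Proof. exact: Dt_X. Qed.

Lemma Dt0 : Dt 0 = 0 :> ratfun1 K.
Proof. exact: derivation0 (Dt_derivation K). Qed.

Lemma F2_y0_follows : follows_fully H ('X, 0) (ode_2F1 a b1 c1).
Proof.
exists P1; split; first exact: pde1_follows.
have y0 : (('X, 0) : {poly K} * {poly K}).2%:F = 0 by rewrite tofrac0.
rewrite ode_2F1_cubic
  (partial_form_cubic (Phi := ('X, 0)) _ _ _ _ Dt_polyX _ Dt0);
  last by rewrite y0 Dt0.
rewrite -F2_y0_identity.
by case: (spec_pde1 (erefl : ('X, 0).1 = 'X) y0).
Qed.

Lemma F2_y1_follows : follows_fully H ('X, 1)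
  (ode_3F2 a b1 (a - c2 + 1) c1 (a + b2 - c2 + 1)).
Proof.
pose e := (rat2C (a + b2 - c2 + 1))%:P%:P : pde K.
(* This is (theta + e) P1 - (theta + b1) P2, each theta being d/dx followed by multiplication by
   x. *)
exists (rat2X%:P%:P * pde_Dx P1 + e * P1
        - (rat2X%:P%:P * pde_Dx P2 + (rat2C b1)%:P%:P * P2)); split.
  apply: pde_followsB; apply: PdeAdd; apply: PdeMul.
  - exact: PdeDx pde1_follows.
  - exact: pde1_follows.
  - exact: PdeDx pde2_follows.
  - exact: pde2_follows.
set Phi := ('X, 1).
have y1 : Phi.2%:F = 1 :> ratfun1 K by rewrite tofrac1.
have d1 : Dt 1 = 0 :> ratfun1 K by exact: derivation1 (Dt_derivation K).
rewrite ode_3F2_cubic (partial_form_cubic (Phi := Phi) _ _ _ _ Dt_polyX _ Dt0);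
  last by rewrite y1 d1.
have eE : rat1C (a + b2 - c2 + 1) = rat1C a + rat1C b2 - rat1C c2 + 1.
  by rewrite !(rat1CD, rat1CN, rat1C1).
have -> : rat1C (a - c2 + 1) = rat1C a - rat1C c2 + 1.
  by rewrite !(rat1CD, rat1CN, rat1C1).
have se := specialized_form_cst Phi (a + b2 - c2 + 1).
rewrite eE in se *; rewrite -F2_y1_identity.
have [s1 s1x _] := spec_pde1 (erefl : Phi.1 = 'X) y1.
have [s2 _ s2x] := spec_pde2 (erefl : Phi.1 = 'X) y1.
have sx := spec_x (erefl : Phi.1 = 'X).
have sb := specialized_form_cst Phi b1.
have rr := specialized_form_ring_rel Phi.
have rD := ring_relD rr; have rN := ring_relN rr; have rM := ring_relM rr.
(* The specialization is assembled along the syntax tree of the witness, which is that of the left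
   side of [F2_y1_identity]. *)
exact: rD (rD _ _ _ _ (rM _ _ _ _ sx s1x) (rM _ _ _ _ se s1))
  (rN _ _ (rD _ _ _ _ (rM _ _ _ _ sx s2x) (rM _ _ _ _ sb s2))).
Qed.

Hypothesis charK : [pchar K] =i pred0.

(** Once z = x / (x - 1) is substituted into the coefficients of [ode_3F2], the computation is
    [moebius_mulsol_cubic]. Characteristic 0 enters through that substitution, by
    [ratfun_comp_rel]. *)
Lemma moebius_ode_3F2_cubic A B C D E :
  let a' := rat1C a in let A' := rat1C A in let B' := rat1C B in
  let C' := rat1C C in let D' := rat1C D in let E' := rat1C E in
  let p := D' + E' + 1 in let q := A' + B' + C' + 3%:R in
  let r := A' * B' + A' * C' + B' * C' + A' + B' + C' + 1 in
  ode_mulsol (dlog_power (1 - rat1X) (- a))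
    (ode_pullback (rat1X / (rat1X - 1)) (ode_3F2 A B C D E)) =
  cubic
     (- (A' * B' * C')
      + a' * (6%:R * x ^+ 2 + 2%:R * x * (p * (x - 1) - q * x)
                 - D' * E' * (x - 1) + r * x)
      + (a' ^+ 2 - a') * (6%:R * x ^+ 2 + x * (p * (x - 1) - q * x))
      + (a' ^+ 3 - 3%:R * a' ^+ 2 + 2%:R * a') * x ^+ 2)
     ((x - 1) * (6%:R * x ^+ 2 + 2%:R * x * (p * (x - 1) - q * x)
                 - D' * E' * (x - 1) + r * x
      + 2%:R * a' * (6%:R * x ^+ 2 + x * (p * (x - 1) - q * x))
      + 3%:R * (a' ^+ 2 - a') * x ^+ 2))
     ((x - 1) ^+ 2 * (6%:R * x ^+ 2 + x * (p * (x - 1) - q * x)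
                 + 3%:R * a' * x ^+ 2))
     (x ^+ 2 * (x - 1) ^+ 3).
Proof.
move=> a' A' B' C' D' E' p q r.
have dd := Dt_derivation K.
have dphi := d_moebius dd (Dt_X K) rat1X_sub1_neq0.
have [d0 [d1 [d2 [d3 [Ep Em]]]]] :=
  moebius_mulsol_cubic dd (Dt_X K) (Dt_C a) rat1X_sub1_neq0 p q r (D' * E')
    (A' * B' * C').
have -> : dlog_power (1 - rat1X) (- a) = - a' * (-1 / (1 - rat1X)).
  rewrite /dlog_power rat1CN (derivationB dd) (derivation1 dd) Dt_X.
  by rewrite sub0r.
pose z : ratfun1 K := rat1X / (rat1X - 1).
(* A nonzero derivative expresses that z is not constant, as substitution requires. *)
have dphi0 : Dt z != 0.
  by rewrite dphi oppr_eq0 invr_eq0 expf_neq0 // rat1X_sub1_neq0.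
have [ev [rr rC rX rE]] := ratfun_comp_rel charK dphi0.
have [r0 r1 r2 r3] :=
  ring_rel_3F2 rr (rC A) (rC B) (rC C) (rC D) (rC E) rX.
have pullE : ode_pullback z (ode_3F2 A B C D E) = cubic d0 d1 d2 d3.
  rewrite -Ep ode_3F2_cubic /ode_pullback /ode_Dt dphi.
  pose T (M : {poly ratfun1 K}) :=
    (- (x - 1) ^- 2)^-1 *: (map_poly (@Dt K) M + 'X * M).
  rewrite (@sum_cubic _ _ (fun c k => ratfun_comp c z *: iter k T 1));
    last by move=> j; rewrite (rE _ _ (ring_rel0 rr)) scale0r.
  by rewrite (rE _ _ r0) (rE _ _ r1) (rE _ _ r2) (rE _ _ r3).
rewrite pullE /ode_mulsol /ode_Dt -Em.
exact: (@sum_cubic _ _ (fun c k => c *: iter k _ 1)) (fun j => scale0r _).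
Qed.

Lemma F2_y1x_follows : follows_fully H ('X, 1 - 'X)
  (ode_mulsol (dlog_power (1 - rat1X) (- a))
     (ode_pullback (rat1X / (rat1X - 1))
        (ode_3F2 a (c1 - b1) (a - c2 + 1) c1 (a + b2 - c2 + 1)))).
Proof.
set Phi := ('X, 1 - 'X).
have y1 : Phi.2%:F = 1 - x :> ratfun1 K by rewrite tofracB tofrac1.
pose cst c := (rat2C c)%:P%:P : pde K.
(* This is x y D (P1 + P2) - s P1 + (c1 - b1 - (a + 1) x) (P1 + P2), with y still independent of x;
   y = 1 - x enters only upon specialization. *)
pose T := rat2X%:P%:P * (rat2Y%:P%:P *
      (pde_Dx P1 + pde_Dx P2 - (pde_Dy P1 + pde_Dy P2)))
    - cst (c1 + c2 - a - b1 - b2 - 1) * P1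
    + (cst (c1 - b1) * (P1 + P2) - cst (a + 1) * (rat2X%:P%:P * (P1 + P2))).
have f1 := pde1_follows; have f2 := pde2_follows.
have fT : pde_follows H T.
  apply: PdeAdd; apply: pde_followsB.
  - apply/PdeMul/PdeMul/pde_followsB; apply: PdeAdd.
    + exact: PdeDx f1.
    + exact: PdeDx f2.
    + exact: PdeDy f1.
    + exact: PdeDy f2.
  - exact: PdeMul f1.
  - exact: PdeMul (PdeAdd f1 f2).
  - exact: PdeMul (PdeMul _ (PdeAdd f1 f2)).
(* The multiple (x - 1) T, written as a difference of consequences of the system. *)
exists (rat2X%:P%:P * T - T); split.
  exact: pde_followsB (PdeMul _ fT) fT.
have dd := Dt_derivation K.
have dN1 : Dt (-1) = 0 :> ratfun1 K.
  by rewrite (derivationN dd) (derivation1 dd) oppr0.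
rewrite moebius_ode_3F2_cubic
  (partial_form_cubic (Phi := Phi) _ _ _ _ Dt_polyX _ dN1);
  last by rewrite y1 (derivationB dd) (derivation1 dd) Dt_X sub0r.
have -> : rat1C (a + b2 - c2 + 1) = rat1C a + rat1C b2 - rat1C c2 + 1.
  by rewrite !(rat1CD, rat1CN, rat1C1).
have -> : rat1C (a - c2 + 1) = rat1C a - rat1C c2 + 1.
  by rewrite !(rat1CD, rat1CN, rat1C1).
have -> : rat1C (c1 - b1) = rat1C c1 - rat1C b1 by rewrite rat1CD rat1CN.
rewrite -F2_y1x_identity.
have [s1 s1x s1y] := spec_pde1 (erefl : Phi.1 = 'X) y1.
have [s2 s2y s2x] := spec_pde2 (erefl : Phi.1 = 'X) y1.
have sx := spec_x (erefl : Phi.1 = 'X).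
have sy := spec_y y1.
have sc := specialized_form_cst Phi.
have ss := sc (c1 + c2 - a - b1 - b2 - 1).
have sb := sc (c1 - b1).
have sa := sc (a + 1).
rewrite !(rat1CD, rat1CN, rat1C1) in ss sb sa.
have rr := specialized_form_ring_rel Phi.
have rD := ring_relD rr; have rN := ring_relN rr; have rM := ring_relM rr.
have s12 := rD _ _ _ _ s1 s2.
have sT := rD _ _ _ _
  (rD _ _ _ _
    (rM _ _ _ _ sx (rM _ _ _ _ sy
      (rD _ _ _ _ (rD _ _ _ _ s1x s2x) (rN _ _ (rD _ _ _ _ s1y s2y)))))
    (rN _ _ (rM _ _ _ _ ss s1)))
  (rD _ _ _ _ (rM _ _ _ _ sb s12)
    (rN _ _ (rM _ _ _ _ sa (rM _ _ _ _ sx s12)))).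
exact: rD (rM _ _ _ _ sx sT) (rN _ _ sT).
Qed.

End Specializations.

Theorem theorem2p1 (R : realType) (a b1 b2 c1 c2 : R[i]) :
  (let E := ode_2F1 a b1 c1 in
   ode_order E = 2%N /\
   follows_fully (appellF2_system a b1 b2 c1 c2) ('X, 0) E)
  /\
  (let E := ode_3F2 a b1 (a - c2 + 1) c1 (a + b2 - c2 + 1) in
   ode_order E = 3%N /\
   follows_fully (appellF2_system a b1 b2 c1 c2) ('X, 1) E)
  /\
  (let E :=
     ode_mulsol (dlog_power (1 - rat1X) (- a))
       (ode_pullback (rat1X / (rat1X - 1))
          (ode_3F2 a (c1 - b1) (a - c2 + 1) c1 (a + b2 - c2 + 1))) in
   ode_order E = 3%N /\
   follows_fully (appellF2_system a b1 b2 c1 c2) ('X, 1 - 'X) E).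
Proof.
have charK := Num.Theory.pchar_num R[i].
split=> /=; last split; split.
(* The orders are read off the leading coefficients x (1 - x), x^2 (1 - x) and x^2 (x - 1)^3,
   nonzero rational functions whatever the parameters. *)
- rewrite /ode_order ode_2F1_cubic size_cubic2 // mulf_neq0 //.
    exact: rat1X_neq0.
  exact: rat1X_1sub_neq0.
- exact: F2_y0_follows.
- rewrite /ode_order ode_3F2_cubic size_cubic3 // mulf_neq0 //.
    exact: expf_neq0 (rat1X_neq0 _).
  exact: rat1X_1sub_neq0.
- exact: F2_y1_follows.
- rewrite /ode_order (moebius_ode_3F2_cubic _ charK) size_cubic3 //.
  apply: mulf_neq0; first exact: expf_neq0 (rat1X_neq0 _).
  exact: expf_neq0 (rat1X_sub1_neq0 _).
- exact: F2_y1x_follows.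
Qed.
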